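(* Let $n\ge 1$ and $m>n+2$ be integers and let $A=(a_{i,j})$ be an $m\times n$ integer matrix. Let $F\subset\{1,\ldots,m\}$ be a subset of cardinality $n$ and let $R=\{1,\ldots,m\}\setminus F$. For distinct $i,j\in R$ let $E(i,j)=F\cup\{i,j\}$ and let $\mathfrak{M}_{E(i,j)}=\mathfrak{M}_{E(i,j)}(A)$ be the enhanced solution matrix associated to $i,j$ (an $m\times m$ integer matrix, defined in the context). Then for all distinct $i,j\in R$, $$A^T\cdot\mathfrak{M}_{E(i,j)}=0.$$ Furthermore, if $A$ has full rank $n$ and $F$ is chosen such that the submatrix $A_F$ has rank $n$, then the matrices $\mathfrak{M}_{E(i,j)}$, indexed by the pairs $i<j$ in $R$, are linearly independent.
   Context: For a subset $J\subseteq\{1,\ldots,m\}$, $A_J$ denotes the submatrix of $A$ consisting of the rows indexed by $J$ (in increasing order) and all columns. Minor matrix: for an $(n+2)\times n$ integer matrix $A'$ and distinct $r,s\in\{1,\ldots,n+2\}$, let $R(r,s)=\{1,\ldots,n+2\}\setminus\{r,s\}$. Define the skew-symmetric $(n+2)\times(n+2)$ integer matrix $M(A')=(m_{r,s})$ by $m_{r,s}=(-1)^{r+s}\det(A'_{R(r,s)})$ if $r<s$, $m_{r,r}=0$, and $m_{r,s}=(-1)^{r+s+1}\det(A'_{R(r,s)})$ if $s<r$. Enhanced solution matrix: for distinct $i,j\in R$, write $E(i,j)=\{e_1<e_2<\cdots<e_{n+2}\}$ and let $M_{E(i,j)}=M(A_{E(i,j)})$. Then $\mathfrak{M}_{E(i,j)}$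 is the $m\times m$ integer matrix whose $(e_r,e_s)$ entry is the $(r,s)$ entry of $M_{E(i,j)}$ for all $1\le r,s\le n+2$, and all of whose other entries are $0$. (It depends only on the unordered pair $\{i,j\}$.) *)

(* Defs.v *)
From HB Require Import structures.
From mathcomp Require Import all_boot all_order all_algebra.
Set Implicit Arguments.
Unset Strict Implicit.
Unset Printing Implicit Defensive.
Import Order.TTheory GRing.Theory Num.Theory.
Local Open Scope ring_scope.

(* [enum_val] enumerates a set of ordinals in increasing order, see
   [enum_val_lt] below. *)
Definition subrows (T : Type) (m n : nat) (A : 'M[T]_(m, n)) (J : {set 'I_m}) :
  'M[T]_(#|J|, n) := rowsub (@enum_val _ (mem J)) A.

(* [conform_mx 0] only transports along [#|J| = k]; the default value 0 is never
   reached when J has k elements, see [subrows_ofE]. *)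
Definition subrows_of (k m n : nat) (A : 'M[int]_(m, n)) (J : {set 'I_m}) :
  'M[int]_(k, n) := conform_mx 0 (subrows A J).

(* Rows are numbered from 0: both indices are shifted by one, so that the
   parity of [r + s] is that of the 1-based convention. *)
Definition minor_mx (n : nat) (A' : 'M[int]_(n.+2, n)) : 'M[int]_n.+2 :=
  \matrix_(r, s)
    let d := \det (subrows_of n A' (~: [set r; s])) in
    if (r < s)%N then (-1) ^+ (r + s) * d
    else if (s < r)%N then (-1) ^+ (r + s + 1) * d
    else 0.

(* For [a \in E], [index a (enum E)] is the position r such that a = e_r. *)
Definition enhanced_mx (m n : nat) (A : 'M[int]_(m, n)) (E : {set 'I_m}) :
  'M[int]_m :=
  \matrix_(a, b)
    if (a \in E) && (b \in E) then
      minor_mx (subrows_of n.+2 A E)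
        (inord (index a (enum E))) (inord (index b (enum E)))
    else 0.

Definition ratmx (m n : nat) (A : 'M[int]_(m, n)) : 'M[rat]_(m, n) :=
  map_mx intr A.

Lemma enum_val_lt (m : nat) (J : {set 'I_m}) (r s : 'I_#|J|) :
  (r < s)%N -> (enum_val r < enum_val s)%N.
Proof.
move=> lt_rs; have x0 := enum_val r.
rewrite !(enum_val_nth x0).
have srt : sorted (fun x y : 'I_m => (x < y)%N) (enum J).
  rewrite /enum_mem; apply: sorted_filter; first by move=> y x z; apply: ltn_trans.
  have := iota_ltn_sorted 0 m; rewrite -val_enum_ord sorted_map enumT.
  exact.
apply: (sorted_ltn_nth _ x0 srt) => //; last 2 first.
- by rewrite inE -cardE.
- by rewrite inE -cardE.
by move=> y x z; apply: ltn_trans.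
Qed.

Lemma subrows_ofE (k m n : nat) (A : 'M[int]_(m, n)) (J : {set 'I_m})
    (hJ : #|J| = k) :
  subrows_of k A J = castmx (hJ, erefl n) (subrows A J).
Proof. by case: k / hJ; rewrite /subrows_of conform_mx_id castmx_id. Qed.

Lemma enhanced_mxE (m n : nat) (A : 'M[int]_(m, n)) (E : {set 'I_m})
    (hE : #|E| = n.+2) (r s : 'I_#|E|) :
  enhanced_mx A E (enum_val r) (enum_val s) =
  minor_mx (subrows_of n.+2 A E) (cast_ord hE r) (cast_ord hE s).
Proof.
have idx (t : 'I_#|E|) : inord (index (enum_val t) (enum E)) = cast_ord hE t.
  apply: val_inj; rewrite /= (enum_val_nth (enum_val t)).
  by rewrite index_uniq ?enum_uniq -?cardE // inordK -?hE.
by rewrite mxE !enum_valP !idx.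
Qed.

(* Main.v *)
(** [A^T *m minor_mx A = 0] is a Laplace expansion: its entry (k, s) is, up to
    sign, the determinant of A without row s and with column k repeated.  For
    independence, a pair i < j of R lies in [E i' j'] only if it is {i', j'}, so
    the entry at (i, j) vanishes in all the matrices but
    [enhanced_mx A (E i j)], where it is the determinant of [A_F] up to sign. *)
Require Import Defs.
From HB Require Import structures.
From mathcomp Require Import all_boot all_order all_algebra.
Set Implicit Arguments.
Unset Strict Implicit.
Unset Printing Implicit Defensive.
Import Order.TTheory GRing.Theory Num.Theory.
Local Open Scope ring_scope.

(** The index type is ['I_k] rather than ['I_#|J|], so that enumerations of different sets compose
    with each other without casts. *)
Definition enum_ord (k m : nat) (J : {set 'I_m}) (hJ : #|J| = k) (t : 'I_k) :
  'I_m := enum_val (cast_ord (esym hJ) t).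

Lemma enum_ordP (k m : nat) (J : {set 'I_m}) (hJ : #|J| = k) (t : 'I_k) :
  enum_ord hJ t \in J.
Proof. exact: enum_valP. Qed.

Lemma enum_ord_surj (k m : nat) (J : {set 'I_m}) (hJ : #|J| = k) (a : 'I_m) :
  a \in J -> exists t, a = enum_ord hJ t.
Proof.
move=> aJ; exists (cast_ord hJ (enum_rank_in aJ a)).
by rewrite /enum_ord cast_ordK enum_rankK_in.
Qed.

Lemma enum_ord_inj (k m : nat) (J : {set 'I_m}) (hJ : #|J| = k) :
  injective (enum_ord hJ).
Proof. by move=> s t /enum_val_inj/cast_ord_inj. Qed.

Lemma enum_ord_lt (k m : nat) (J : {set 'I_m}) (hJ : #|J| = k) (s t : 'I_k) :
  (s < t)%N -> (enum_ord hJ s < enum_ord hJ t)%N.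
Proof. by move=> st; apply: enum_val_lt. Qed.

Lemma enum_ord_ltE (k m : nat) (J : {set 'I_m}) (hJ : #|J| = k) (s t : 'I_k) :
  (enum_ord hJ s < enum_ord hJ t)%N = (s < t)%N.
Proof.
case: (ltngtP s t) => [|lt|/val_inj ->]; last by rewrite ltnn.
  exact: enum_ord_lt.
by apply/negbTE; rewrite -leqNgt ltnW // enum_ord_lt.
Qed.

Lemma big_enum_ord (T : Type) (idx : T) (op : Monoid.com_law idx) (k m : nat)
    (J : {set 'I_m}) (hJ : #|J| = k) (G : 'I_m -> T) :
  \big[op/idx]_(a in J) G a = \big[op/idx]_(t < k) G (enum_ord hJ t).
Proof.
case: k / hJ; rewrite big_enum_val; apply: eq_bigr => t _.
by rewrite /enum_ord cast_ord_id.
Qed.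

(** Both maps are injective into a set of k elements, so their codomains are strictly sorted lists
    with the same members, hence equal lists. *)
Lemma increasing_enum_ord (k m : nat) (J : {set 'I_m}) (hJ : #|J| = k)
    (f : 'I_k -> 'I_m) :
  {homo f : s t / (s < t)%N >-> (s < t)%N} -> (forall t, f t \in J) ->
  f =1 enum_ord hJ.
Proof.
move=> f_lt fJ.
have sorted_codom (g : 'I_k -> 'I_m) :
    {homo g : s t / (s < t)%N >-> (s < t)%N} ->
    sorted (relpre val ltn) (codom g).
  move=> g_lt; rewrite /codom /image_mem sorted_map.
  apply: (@sub_sorted _ (relpre val ltn)); first by move=> s t /g_lt.
  by rewrite -sorted_map val_enum_ord iota_ltn_sorted.
have codomJ (g : 'I_k -> 'I_m) :
    {homo g : s t / (s < t)%N >-> (s < t)%N} -> (forall t, g t \in J) ->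
    codom g =i J.
  move=> g_lt gJ; have g_inj : injective g.
    move=> s t gst; case: (ltngtP s t) => [/g_lt|/g_lt|/val_inj//];
      by rewrite gst ltnn.
  apply/subset_cardP; last by apply/subsetP => _ /codomP[t ->].
  by rewrite card_codom // card_ord.
have eq_codom : codom f = codom (enum_ord hJ).
  apply: (@irr_sorted_eq _ (relpre val ltn)).
  - by move=> y x z /=; apply: ltn_trans.
  - by move=> x /=; rewrite ltnn.
  - exact: sorted_codom.
  - by apply: sorted_codom => s t; apply: enum_ord_lt.
  move=> a; rewrite !codomJ //; first by move=> s t; apply: enum_ord_lt.
  by move=> t; apply: enum_ordP.
by move=> t; move/eq_in_map: eq_codom; apply; rewrite mem_enum.
Qed.

Lemma subrows_of_rowsub (k m n : nat) (A : 'M[int]_(m, n)) (J : {set 'I_m})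
    (hJ : #|J| = k) :
  subrows_of k A J = rowsub (enum_ord hJ) A.
Proof.
rewrite (subrows_ofE _ hJ); apply/matrixP => s t.
by rewrite castmxE !mxE cast_ord_id.
Qed.

(** Any increasing parametrization of [J] may replace its enumeration; it is applied below to double
    lifts and to composed enumerations. *)
Lemma subrows_of_increasing (k m n : nat) (A : 'M[int]_(m, n))
    (J : {set 'I_m}) (f : 'I_k -> 'I_m) :
  #|J| = k -> {homo f : s t / (s < t)%N >-> (s < t)%N} ->
  (forall t, f t \in J) -> subrows_of k A J = rowsub f A.
Proof.
move=> hJ f_lt fJ; rewrite (subrows_of_rowsub _ hJ).
by apply/matrixP => s t; rewrite !mxE (increasing_enum_ord hJ f_lt fJ).
Qed.

Lemma ltn_lift (n : nat) (h : 'I_n) (s t : 'I_n.-1) :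
  (s < t)%N -> (lift h s < lift h t)%N.
Proof. by rewrite /= !ltnNge leq_bump2. Qed.

Lemma card_setC2 (n : nat) (r s : 'I_n.+2) : r != s -> #|~: [set r; s]| = n.
Proof. by move=> rs; rewrite cardsCs setCK cards2 rs card_ord subn2. Qed.

(** Indexing the rows other than [s] by [lift s i] merges the two sign rules: for [s <= i] the row
    is i + 1, and this shift cancels the extra 1 in the exponent below the diagonal. *)
Lemma minor_mx_lift (n : nat) (A : 'M[int]_(n.+2, n)) (s : 'I_n.+2)
    (i : 'I_n.+1) :
  minor_mx A (lift s i) s = (-1) ^+ (s + i) * \det (row' i (row' s A)).
Proof.
have -> : row' i (row' s A) = subrows_of n A (~: [set lift s i; s]).
  rewrite (@subrows_of_increasing n _ _ _ _ (fun t => lift s (lift i t))).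
  - by apply/matrixP => t k; rewrite !mxE.
  - by rewrite card_setC2 // eq_sym neq_lift.
  - by move=> t u tu; do 2!apply: ltn_lift.
  move=> t; rewrite !inE negb_or (inj_eq lift_inj) eq_sym neq_lift.
  by rewrite eq_sym neq_lift.
rewrite mxE /= /bump; case: (leqP s i) => [si|is_].
  rewrite add1n ltnNge leqW // ltnS si.
  by rewrite addn1 addSn !exprS !mulN1r opprK addnC.
by rewrite add0n is_ addnC.
Qed.

Lemma mul_trmx_minor_mx (n : nat) (A : 'M[int]_(n.+2, n)) :
  A^T *m minor_mx A = 0.
Proof.
apply/matrixP => k s; rewrite !mxE (bigD1_ord s) //= !mxE !ltnn mulr0 add0r.
(* [C] is [A] without row [s], with column [k] prepended; its columns [ord0] and [lift ord0 k]
   coincide. *)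
pose C : 'M_n.+1 := \matrix_(i, j)
  A (lift s i) (if unlift ord0 j is Some l then l else k).
have C0 i : C i ord0 = A (lift s i) k by rewrite mxE unlift_none.
have CS i j : C i (lift ord0 j) = A (lift s i) j by rewrite mxE liftK.
have : \det C = 0.
  rewrite -det_tr; apply: (determinant_alternate (neq_lift ord0 k)) => i.
  by rewrite [LHS]mxE [RHS]mxE C0 CS.
(* The factor (-1)^s turns the cofactor sign (-1)^i into the sign of [minor_mx_lift]. *)
rewrite (expand_det_col _ ord0) => /(congr1 ( *%R ((-1) ^+ s))).
rewrite mulr0 mulr_sumr => detC; rewrite -[RHS]detC; apply: eq_bigr => i _.
rewrite mxE minor_mx_lift C0 /cofactor addn0 exprD mulrCA !mulrA.
have -> : row' i (row' s A) = row' i (col' ord0 C) :> 'M_n.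
  by apply/matrixP => t j; rewrite [RHS]mxE [RHS]mxE CS !mxE.
by congr (_ * _); apply: mulrAC.
Qed.

Lemma enhanced_mx_enum (m n : nat) (A : 'M[int]_(m, n)) (E : {set 'I_m})
    (hE : #|E| = n.+2) (r s : 'I_n.+2) :
  enhanced_mx A E (enum_ord hE r) (enum_ord hE s) =
  minor_mx (subrows_of n.+2 A E) r s.
Proof. by rewrite (enhanced_mxE _ hE) !cast_ordKV. Qed.

(** Entries outside E x E vanish, so the sum over all rows reduces to the one for the minor matrix
    of the submatrix on [E]. *)
Lemma mul_trmx_enhanced_mx (m n : nat) (A : 'M[int]_(m, n)) (E : {set 'I_m}) :
  #|E| = n.+2 -> A^T *m enhanced_mx A E = 0.
Proof.
move=> hE; apply/matrixP => k b; rewrite !mxE.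
have [bE|bE] := boolP (b \in E); last first.
  by apply: big1 => a _; rewrite !mxE (negbTE bE) andbF mulr0.
have [s ->] := enum_ord_surj hE bE.
rewrite (bigID (mem E)) /= [X in _ + X]big1 ?addr0; last first.
  by move=> a aE; rewrite !mxE (negbTE aE) mulr0.
rewrite (big_enum_ord _ hE).
have /matrixP/(_ k s) := mul_trmx_minor_mx (subrows_of n.+2 A E).
rewrite !mxE => sum0; rewrite -[RHS]sum0; apply: eq_bigr => r _.
by rewrite enhanced_mx_enum (subrows_of_rowsub _ hE) !mxE.
Qed.

(** Deleting the positions of i and j from E leaves F. The exponent stays existential because only
    nonvanishing matters later. *)
Lemma enhanced_mx_new_entry (m n : nat) (A : 'M[int]_(m, n)) (F : {set 'I_m})
    (i j : 'I_m) :
  #|F| = n -> #|F :|: [set i; j]| = n.+2 -> i \notin F -> j \notin F ->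
  (i < j)%N ->
  exists k, enhanced_mx A (F :|: [set i; j]) i j =
    (-1) ^+ k * \det (subrows_of n A F).
Proof.
set E := F :|: _ => hF hE iF jF ij.
have [|r rE] := @enum_ord_surj _ _ _ hE i; first by rewrite !inE eqxx orbT.
have [|s sE] := @enum_ord_surj _ _ _ hE j; first by rewrite !inE eqxx !orbT.
have rs : (r < s)%N by rewrite -(enum_ord_ltE hE) -rE -sE.
have hC : #|~: [set r; s]| = n by rewrite card_setC2 // neq_ltn rs.
exists (r + s)%N; rewrite [in LHS]rE [in LHS]sE enhanced_mx_enum mxE rs /=.
congr (_ * \det _); rewrite (subrows_of_rowsub _ hC).
rewrite (subrows_of_rowsub _ hE).
rewrite (@subrows_of_increasing _ _ _ _ _
  (enum_ord hE \o enum_ord hC) hF).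
- by apply/matrixP => t k; rewrite !mxE.
- by move=> t u tu; do 2!apply: enum_ord_lt.
(* An element of E is in F or is i or j; the last two would put its position in the deleted set {r,
   s}. *)
move=> t; have := enum_ordP hC t; have := enum_ordP hE (enum_ord hC t).
rewrite {1}/E !inE /= => /or3P[//|/eqP|/eqP].
- by move=> et; rewrite (enum_ord_inj (etrans et rE)) eqxx.
- by move=> et; rewrite (enum_ord_inj (etrans et sE)) eqxx orbT.
Qed.

(** Reading the entry at [pos p] kills every [f q] with q != p, so [f p] cannot be a combination of
    the others. *)
Lemma free_entries (K : fieldType) (I : eqType) (m n : nat)
    (f : I -> 'M[K]_(m, n)) (pos : I -> 'I_m * 'I_n) (s : seq I) :
  uniq s -> {in s, forall p, f p (pos p).1 (pos p).2 != 0} ->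
  {in s &, forall p q, p != q -> f q (pos p).1 (pos p).2 = 0} ->
  free (map f s).
Proof.
elim: s => [|p s IHs] /=; first by rewrite nil_free.
move=> /andP[ps us] nz z; rewrite free_cons IHs //; last first.
- by move=> q r qs rs; apply: z; rewrite inE (qs, rs) orbT.
- by move=> q qs; apply: nz; rewrite inE qs orbT.
rewrite andbT; apply/negP => /(@coord_span _ _ _ (in_tuple _)) fp.
have /negP := nz p (mem_head _ _); apply; rewrite fp summxE big1 // => t _.
have lt_t : (t < size s)%N by rewrite -(size_map f).
rewrite mxE (nth_map p) // z ?mulr0 ?mem_head // ?inE ?mem_nth ?orbT //.
by apply: contraNneq ps => ->; rewrite mem_nth.
Qed.

Lemma det_subrows_of_neq0 (m n : nat) (A : 'M[int]_(m, n)) (F : {set 'I_m}) :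
  #|F| = n -> \rank (ratmx (subrows A F)) = n -> \det (subrows_of n A F) != 0.
Proof.
move=> hF rkF.
(* The number of rows is a separate variable [k], so that the cast can be eliminated while the width
   n stays fixed. *)
have rank_cast k (h : #|F| = k) :
    \rank (ratmx (subrows_of k A F)) = \rank (ratmx (subrows A F)).
  by rewrite (subrows_ofE _ h); case: k / h; rewrite castmx_id.
have := rank_cast n hF; rewrite rkF.
move=> /eqP; rewrite -/(row_free _) row_free_unit unitmxE unitfE.
by rewrite /ratmx det_map_mx intr_eq0.
Qed.

Theorem theorem4p4 (n m : nat) (hn : (1 <= n)%N) (hm : (n + 2 < m)%N)
    (A : 'M[int]_(m, n)) (F : {set 'I_m}) (hF : #|F| = n) :
  let R := ~: F in
  let E := fun i j : 'I_m => F :|: [set i; j] in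
  (forall i j : 'I_m, i \in R -> j \in R -> i != j ->
     A^T *m enhanced_mx A (E i j) = 0)
  /\
  (\rank (ratmx A) = n -> \rank (ratmx (subrows A F)) = n ->
   free [seq ratmx (enhanced_mx A (E p.1 p.2))
        | p : 'I_m * 'I_m in
          [set p : 'I_m * 'I_m | [&& p.1 \in R, p.2 \in R & (p.1 < p.2)%N]]]).
Proof.
move=> R E.
have hE i j : i \in R -> j \in R -> i != j -> #|E i j| = n.+2.
  rewrite !inE => iF jF ij; rewrite cardsU cards2 ij hF disjoint_setI0.
    by rewrite cards0 subn0 addn2.
  rewrite disjoint_sym disjoints_subset; apply/subsetP => a.
  by rewrite !inE => /orP[]/eqP->.
split=> [i j iR jR ij|_ rkF]; first by apply/mul_trmx_enhanced_mx/hE.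
have detF := det_subrows_of_neq0 hF rkF.
(* Each pair serves as its own distinguished matrix position, hence [id]. *)
apply: (@free_entries _ _ _ _ _ id); first exact: enum_uniq.
  move=> [i j]; rewrite mem_enum inE /= => /and3P[iR jR ij].
  have hEij := hE i j iR jR; rewrite neq_ltn ij in hEij.
  rewrite !inE in iR jR.
  have [k ek] := enhanced_mx_new_entry A hF (hEij isT) iR jR ij.
  by rewrite mxE ek intr_eq0 mulf_neq0 // signr_eq0.
move=> [i j] [i' j']; rewrite !mem_enum !inE /= => /and3P[iF jF ij].
move=> /and3P[_ _ ij'] neq; rewrite !mxE !inE (negbTE iF) (negbTE jF) /=.
(* Otherwise i and j both lie in {i', j'}: i = j contradicts [ij], the same pair contradicts [neq],
   and the swapped pair contradicts [ij']. *)
case: ifP => // /andP[/orP[]/eqP ei /orP[]/eqP ej]; subst i j => //.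
- by rewrite ltnn in ij.
- by rewrite eqxx in neq.
- by rewrite ltnNge (ltnW ij') in ij.
- by rewrite ltnn in ij.
Qed.
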